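(* Let $m,n,p,k,l$ be positive integers, and suppose that linear subspaces $\mathcal{K}\subseteq\mathbb{M}_{mn}$ and $\mathcal{L}\subseteq\mathbb{M}_{np}$ are $k$-transitive and $l$-transitive respectively. Then the linear span $\operatorname{span}\mathcal{K}\mathcal{L}=\operatorname{span}\{KL:K\in\mathcal{K},\,L\in\mathcal{L}\}\subseteq\mathbb{M}_{mp}$ is $\min\{k+l,m,p\}$-transitive.
   Context: $\mathbb{M}_{mn}$ is the complex vector space of $m\times n$ complex matrices, identified with the linear maps $\mathbb{C}^n\to\mathbb{C}^m$. A linear subspace $\mathcal{L}\subseteq\mathbb{M}_{mn}$ is $k$-transitive if for every choice of $k$ linearly independent vectors $x_1,\dots,x_k\in\mathbb{C}^n$ and arbitrary vectors $y_1,\dots,y_k\in\mathbb{C}^m$ there is $A\in\mathcal{L}$ with $Ax_i=y_i$ for $1\le i\le k$; when $k>n$ (so that no such vectors exist), $k$-transitive means by convention $\mathcal{L}=\mathbb{M}_{mn}$. With this convention, $\mathcal{L}$ is $k$-transitive if and only if its pre-annihilator $\mathcal{L}_\perp=\{T\in\mathbb{M}_{nm}:\operatorname{Tr}(AT)=0\text{ for all }A\in\mathcal{L}\}$ contains no nonzero element of rank at most $k$ (Azoff). *)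

(* Defs.v *)
From HB Require Import structures.
From mathcomp Require Import all_boot all_order all_algebra.
From mathcomp Require Import mathcomp_extra boolp classical_sets reals complex.

Set Implicit Arguments.
Unset Strict Implicit.
Unset Printing Implicit Defensive.

Import Order.TTheory GRing.Theory Num.Theory.
Local Open Scope ring_scope.
Local Open Scope classical_set_scope.

(* Matrices act on column vectors: A : 'M_(m, n) is the map x |-> A *m x from
   'cV_n to 'cV_m.  For k > n there are no k independent vectors in 'cV_n, and
   k-transitivity then means, by convention, that L is the whole space. *)
Definition ktransitive (F : fieldType) (m n k : nat) (L : set 'M[F]_(m, n)) :
    Prop :=
  if (k <= n)%N then
    forall (x : k.-tuple 'cV[F]_n) (y : k.-tuple 'cV[F]_m), free x ->
      exists2 A, L A & forall i : 'I_k, A *m tnth x i = tnth y i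
  else L = [set: 'M[F]_(m, n)].

(* The span in vector.v only takes a finite sequence of vectors; the products
   to be spanned here form an infinite set. *)
Definition lspan (F : fieldType) (V : lmodType F) (S : set V) : set V :=
  [set v | exists (r : nat) (a : 'I_r -> F) (s : 'I_r -> V),
     (forall i, S (s i)) /\ v = \sum_(i < r) a i *: s i].

Definition span_mul (F : fieldType) (m n p : nat)
    (K : {vspace 'M[F]_(m, n)}) (L : {vspace 'M[F]_(n, p)}) :
    set 'M[F]_(m, p) :=
  lspan [set A *m B | A in [set` K] & B in [set` L]].

(* Main.v *)
Require Import Defs.
From HB Require Import structures.
From mathcomp Require Import all_boot all_order all_algebra.
From mathcomp Require Import mathcomp_extra boolp classical_sets reals complex.

Import GRing.Theory.
Local Open Scope ring_scope.
Local Open Scope classical_set_scope.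

(** Why the theorem is true.  Put q = min(k + l, m, p), and let the columns of
    the p x q matrix X be linearly independent.  The task is to show that the
    matrices A X, for A in span KL, are all the m x q matrices.  If they are
    not, duality for the trace form yields a nonzero S with tr (A X S) = 0 for
    all A in span KL ([trace_separation]).  Then T = X S is nonzero, has rank
    at most q <= k + l, and satisfies tr (A B T) = 0 for all A in K, B in L.
    This is excluded by two facts.

    - [ktransitive_low_rank]: some B in L makes B T nonzero and of rank at most
      k.  Let r be the rank of T.  If r <= l, transitivity yields B T of rank 1.
      If r > l, it lets one prescribe B on l independent vectors of the range
      of T.  Killing l - 1 of them and not the
      last one only gives a rank of at most r - l + 1, which is one too many
      when r = k + l.  The missing unit comes from an eigenvector: let z be the
      l-th vector, let v be a further vector of the range, and for each y pick,
      linearly in y, some B_y in L that maps z to y and kills the other l - 1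
      vectors.  Then y |-> B_y v is an endomorphism of the nonzero space F^n,
      and over an algebraically closed field it has an eigenvector y
      ([ktransitive_eigenvector]).  For that y, B_y sends both z and v into the
      line spanned by y, so that l + 1 independent vectors have their images in
      a line and the rank drops to r - l.

    - [ktransitive_trace]: a k-transitive K contains, for every nonzero U of
      rank at most k, some A with tr (A U) <> 0.  Applied to U = B T, this
      contradicts tr (A B T) = 0. *)

Lemma mxtrace_nondegenerate {F : fieldType} {m n : nat} {U : 'M[F]_(m, n)} :
  U != 0 -> exists Y : 'M[F]_(n, m), \tr (Y *m U) != 0.
Proof.
move=> /matrix0Pn [i [j Uij]].
exists (delta_mx j i); rewrite /mxtrace (bigD1 j) //= big1 ?addr0.
  rewrite mxE (bigD1 i) //= big1 ?addr0 ?mxE ?eqxx ?mul1r // => k /negPf ki.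
  by rewrite mxE ki andbF mul0r.
move=> k /negPf kj; rewrite mxE big1 // => h _.
by rewrite mxE kj mul0r.
Qed.

(** Every linear functional on matrices is A |-> tr (A S) for some S.  Only the
    counting half of this duality is needed: if no S except 0 annihilates W,
    then evaluating tr (_ S) on a basis of W embeds the n x m matrices S into
    F^(dim W), so dim W is at least n m. *)
Lemma trace_separation {F : fieldType} {m n : nat} (W : {vspace 'M[F]_(m, n)}) :
  (forall S : 'M[F]_(n, m), (forall A, A \in W -> \tr (A *m S) = 0) -> S = 0) ->
  W = fullv.
Proof.
move=> sep.
pose f (S : 'M[F]_(n, m)) := \row_(i < \dim W) \tr ((vbasis W)`_i *m S).
have f_lin : linear f.
  move=> a S T; apply/rowP => i.
  by rewrite !mxE mulmxDr -scalemxAr mxtraceD mxtraceZ.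
pose f_ := GRing.isLinear.Build _ _ _ _ f f_lin.
pose g : {linear 'M[F]_(n, m) -> 'rV[F]_(\dim W)} := HB.pack f f_.
have ker0 : lker (linfun g) = 0%VS.
  apply/eqP; rewrite -subv0; apply/subvP => S; rewrite memv_ker lfunE /= memv0.
  move=> /eqP fS0; apply/eqP/sep => A /coord_vbasis ->.
  rewrite mulmx_suml raddf_sum /= big1 // => i _.
  have := congr1 (fun u : 'rV_(\dim W) => u 0 i) fS0; rewrite !mxE => tr0.
  by rewrite -scalemxAl mxtraceZ tr0 mulr0.
apply/eqP; rewrite eqEdim subvf dimvf dim_matrix mulrC -(dim_matrix F) -dimvf.
rewrite -(limg_dim_eq (f := linfun g)) ?ker0 ?capv0 //.
by rewrite (leq_trans (dimvS (subvf _))) // dimvf dim_matrix mul1r.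
Qed.

(** The products of the elements of two bases already span all products, by
    bilinearity; hence linear algebra with a finite-dimensional V applies to
    [span_mul], which is only a set. *)
Lemma span_mul_vspace {F : fieldType} {m n p : nat}
    (K : {vspace 'M[F]_(m, n)}) (L : {vspace 'M[F]_(n, p)}) :
  exists2 V : {vspace 'M[F]_(m, p)},
    (forall A B, A \in K -> B \in L -> A *m B \in V)
    & (forall C, C \in V -> span_mul K L C).
Proof.
pose X := [seq A *m B | A <- vbasis K, B <- vbasis L].
exists <<X>>%VS => [A B /coord_vbasis-> /coord_vbasis-> | C].
  rewrite mulmx_suml memv_suml // => i _; rewrite mulmx_sumr memv_suml // => j _.
  rewrite -scalemxAl -scalemxAr !memvZ // memv_span // allpairs_f //.
    by rewrite mem_nth ?size_tuple.
  by rewrite mem_nth ?size_tuple.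
move=> /(coord_span (X := in_tuple X)) defC.
exists (size X), (fun i => coord (in_tuple X) i C), (fun i => X`_i).
split=> // i.
have /allpairsP [[A B] [/= AK BL ->]] : X`_i \in X by rewrite mem_nth.
by exists A; [exact: vbasis_mem AK | exists B; [exact: vbasis_mem BL |]].
Qed.

(** The working form of k-transitivity: values can be prescribed on any r <= k
    independent columns, and the convention for k > n no longer has to be
    treated apart. *)
Lemma ktransitive_mx {F : fieldType} {m n k r : nat} {L : set 'M[F]_(m, n)}
    {Z : 'M[F]_(n, r)} (Y : 'M[F]_(m, r)) :
  ktransitive k L -> (r <= k)%N -> row_full Z ->
  exists2 A, L A & A *m Z = Y.
Proof.
rewrite /ktransitive => Ltrans le_rk Zfull.
have [le_kn | lt_nk] := leqP k n; last first.
  have [Zi ZiZ] := row_fullP Zfull.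
  have -> : L = [set: 'M[F]_(m, n)] by move: Ltrans; rewrite leqNgt lt_nk.
  by exists (Y *m Zi); rewrite // -mulmxA ZiZ mulmx1.
rewrite le_kn in Ltrans.
have Punit := col_ebase_unit Z; have Qunit := row_ebase_unit Z.
have defZ := mulmx_ebase Z; rewrite (eqP Zfull) in defZ.
set P := col_ebase Z in Punit defZ; set Q := row_ebase Z in Qunit defZ.
(* P is invertible and its first r columns are those of Z up to Q, so its first
   k columns complete Z to k independent ones. *)
pose P' : 'M_(n, k) := P *m pid_mx k.
have P'left : (pid_mx k *m invmx P) *m P' = 1%:M :> 'M_k.
  by rewrite /P' mulmxA mulmxKV // pid_mx_id // pid_mx_1.
pose x := [tuple col j P' | j < k].
pose Y' : 'M_(m, k) := Y *m invmx Q *m pid_mx r.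
pose y := [tuple col j Y' | j < k].
have x_free : free x.
  apply/freeP => c; under eq_bigr do rewrite -tnth_nth tnth_mktuple.
  move=> sum0 i.
  have : P' *m (\col_j c j) = 0.
    rewrite -[RHS]sum0; apply/colP => a; rewrite mxE summxE.
    by apply: eq_bigr => b _; rewrite !mxE mulrC.
  move/(congr1 (mulmx (pid_mx k *m invmx P : 'M_(k, n)))).
  rewrite [LHS]mulmxA P'left mul1mx mulmx0.
  by move/colP/(_ i); rewrite !mxE.
have [A LA Axy] := Ltrans x y x_free.
have AP' : A *m P' = Y'.
  apply/matrixP => a b; have := Axy b.
  rewrite !tnth_mktuple [col b P']colE mulmxA -colE => /colP/(_ a).
  by rewrite [LHS]mxE [RHS]mxE.
exists A => //.
have pidE : pid_mx r = pid_mx k *m (pid_mx r : 'M[F]_(k, r)) :> 'M_(n, r).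
  by rewrite mul_pid_mx (minn_idPr le_rk) (minn_idPr le_rk).
rewrite -defZ pidE (mulmxA P) -/P' (mulmxA A) (mulmxA A) AP' /Y'.
by rewrite -(mulmxA (Y *m _)) pid_mx_id // pid_mx_1 mulmx1 mulmxKV.
Qed.

(** One half of the duality between k-transitivity and ranks in the annihilator:
    writing U = C R with C of full column rank r <= k, transitivity makes A C
    arbitrary, so tr (A U) = tr (A C R) is not always 0. *)
Lemma ktransitive_trace {F : fieldType} {m n k : nat} {K : set 'M[F]_(m, n)}
    {U : 'M[F]_(n, m)} :
  ktransitive k K -> U != 0 -> (\rank U <= k)%N ->
  exists2 A, K A & \tr (A *m U) != 0.
Proof.
move=> Ktrans U0 rkU.
have RB0 : row_base U != 0.
  by apply: contraNneq U0 => RB0; rewrite -(mulmx_base U) RB0 mulmx0.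
have [Y trY] := mxtrace_nondegenerate RB0.
have [A KA AY] := ktransitive_mx Y Ktrans rkU (col_base_full U).
by exists A; rewrite // -(mulmx_base U) mulmxA AY.
Qed.

(** The columns of Z other than the j-th are killed, the j-th is sent to y, and
    the extra vector v follows y into the same line.  On a basis of values y the
    required matrices come from transitivity; extending linearly makes B v a
    linear function N of y, and the y sought is an eigenvector of N. *)
Lemma ktransitive_eigenvector {F : closedFieldType} {n p l : nat}
    {L : {vspace 'M[F]_(n, p)}} {Z : 'M[F]_(p, l)} (v : 'cV[F]_p) (j : 'I_l) :
  (0 < n)%N -> ktransitive l [set` L] -> row_full Z ->
  exists2 B, B \in L & exists (a : F) (y : 'cV[F]_n),
    [/\ y != 0, B *m Z = y *m delta_mx 0 j & B *m v = a *: y].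
Proof.
move=> n_gt0 Ltrans Zfull.
have /fin_all_exists2 [B BL BZ] (i : 'I_n) :
    exists2 B, B \in L & B *m Z = delta_mx i j.
  exact: ktransitive_mx Ltrans (leqnn l) Zfull.
(* N is transposed because eigenvectors are row vectors here. *)
pose N := \matrix_i (B i *m v)^T.
have /closed_rootP [a] : size (char_poly N) != 1.
  by rewrite size_char_poly eqSS -lt0n.
rewrite -eigenvalue_root_char => /eigenvalueP [w wN w0].
exists (\sum_i w 0 i *: B i).
  by rewrite memv_suml // => i _; rewrite memvZ.
exists a, w^T; split.
- by rewrite trmx_eq0.
- rewrite [w in w^T]row_sum_delta raddf_sum /= !mulmx_suml.
  apply: eq_bigr => i _; rewrite -scalemxAl BZ linearZ /= -scalemxAl trmx_delta.
  by rewrite mul_delta_mx.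
rewrite -linearZ /= -wN mulmx_sum_row raddf_sum /= mulmx_suml.
by apply: eq_bigr => i _; rewrite rowK linearZ /= trmxK -scalemxAl.
Qed.

(** The gain over mere transitivity: l + 1 columns of Z, not just l, can be sent
    into one line, so that B Z has rank at most 1 + (r - l - 1) = r - l.  When
    r <= l there is no further column to use, but B Z can be prescribed
    entirely and taken of rank 1. *)
Lemma ktransitive_low_rank_col {F : closedFieldType} {n p r k l : nat}
    {L : {vspace 'M[F]_(n, p)}} {Z : 'M[F]_(p, r)} :
  (0 < n)%N -> (0 < k)%N -> (0 < l)%N -> (0 < r)%N -> (r <= k + l)%N ->
  ktransitive l [set` L] -> row_full Z ->
  exists B, [/\ B \in L, B *m Z != 0 & (\rank (B *m Z) <= k)%N].
Proof.
move=> n_gt0 k_gt0 l_gt0 r_gt0 le_rkl Ltrans Zfull.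
have [le_rl | lt_lr] := leqP r l.
  pose D : 'M[F]_(n, r) := delta_mx (Ordinal n_gt0) (Ordinal r_gt0).
  have [B BL BZ] := ktransitive_mx D Ltrans le_rl Zfull.
  exists B; split=> //; last by rewrite BZ mxrank_delta.
  by rewrite BZ -mxrank_eq0 mxrank_delta.
have [s def_r] : exists s, r = (l + 1 + s)%N.
  by exists (r - l.+1)%N; rewrite addn1 subnKC.
subst r.
pose Z0 := lsubmx (lsubmx Z); pose v := rsubmx (lsubmx Z); pose Z1 := rsubmx Z.
have defZ : Z = row_mx (row_mx Z0 v) Z1 by rewrite !hsubmxK.
have Z0full : row_full Z0.
  have [E EZ] := row_fullP Zfull; apply/row_fullP.
  pose incl : 'M[F]_(l + 1 + s, l) := col_mx (col_mx 1%:M 0) 0.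
  have Z0E : Z0 = Z *m incl.
    by rewrite [in RHS]defZ !mul_row_col mulmx1 !mulmx0 !addr0.
  exists (row_mx (row_mx 1%:M 0) 0 *m E).
  by rewrite Z0E mulmxA -(mulmxA _ E) EZ mulmx1 !mul_row_col mulmx1 !mulmx0 !addr0.
have [B BL [a [y [y0 BZ0 Bv]]]] :=
  ktransitive_eigenvector v (Ordinal l_gt0) n_gt0 Ltrans Z0full.
exists B; split=> //.
  apply: contraNneq y0 => BZ_eq0.
  have : B *m Z0 = 0 by rewrite /Z0 !mulmx_lsub BZ_eq0 !linear0.
  rewrite BZ0 => /(congr1 (fun M => M *m (delta_mx (Ordinal l_gt0) 0 : 'cV_l))).
  rewrite -mulmxA mul_delta_mx mul0mx [delta_mx 0 0]mx11_scalar mxE !eqxx.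
  by rewrite mulmx1 => ->.
pose c : 'rV[F]_(l + 1) := row_mx (delta_mx 0 (Ordinal l_gt0)) a%:M.
(* The first l + 1 columns of B Z are multiples of y, so B Z factors through
   dimension 1 + s. *)
have -> : B *m Z = row_mx y (B *m Z1) *m block_mx c 0 0 1%:M.
  rewrite mul_row_block !mulmx0 mulmx1 addr0 add0r.
  by rewrite defZ !mul_mx_row BZ0 Bv -mul_mx_scalar.
rewrite (leq_trans (mulmx_max_rank _ _)) //.
by rewrite -(leq_add2l l) addnA (leq_trans le_rkl) // addnC.
Qed.

Lemma ktransitive_low_rank {F : closedFieldType} {n p m k l : nat}
    {L : {vspace 'M[F]_(n, p)}} {T : 'M[F]_(p, m)} :
  (0 < n)%N -> (0 < k)%N -> (0 < l)%N -> ktransitive l [set` L] ->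
  T != 0 -> (\rank T <= k + l)%N ->
  exists B, [/\ B \in L, B *m T != 0 & (\rank (B *m T) <= k)%N].
Proof.
move=> n_gt0 k_gt0 l_gt0 Ltrans T0 rkT.
have rT_gt0 : (0 < \rank T)%N by rewrite lt0n mxrank_eq0.
have [B [BL BC0 rkBC]] := ktransitive_low_rank_col n_gt0 k_gt0 l_gt0 rT_gt0 rkT
  Ltrans (col_base_full T).
have defBT : B *m T = B *m col_base T *m row_base T by rewrite -mulmxA mulmx_base.
exists B; split=> //; last first.
  by rewrite defBT (leq_trans (mxrankM_maxl _ _)).
by rewrite defBT -mxrank_eq0 mxrankMfree ?row_base_free // mxrank_eq0.
Qed.

(** Here q <= p is what makes q-transitivity a condition on independent vectors;
    a target q > p would mean that the span is the whole matrix space. *)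
Lemma span_mul_ktransitive {F : closedFieldType} {m n p k l q : nat}
    (K : {vspace 'M[F]_(m, n)}) (L : {vspace 'M[F]_(n, p)}) :
  (0 < n)%N -> (0 < k)%N -> (0 < l)%N -> (q <= p)%N -> (q <= k + l)%N ->
  ktransitive k [set` K] -> ktransitive l [set` L] ->
  ktransitive q (span_mul K L).
Proof.
move=> n_gt0 k_gt0 l_gt0 le_qp le_qkl Ktrans Ltrans.
rewrite /ktransitive le_qp => x y x_free.
pose X := \matrix_(i, j) tnth x j i 0; pose Y := \matrix_(i, j) tnth y j i 0.
have [E EX] : exists E, E *m X = 1%:M.
  apply/row_fullP; rewrite /row_full -mxrank_tr; apply: inj_row_free => c cX0.
  apply/rowP => i; rewrite mxE; apply: (freeP x_free (c 0)).
  apply/colP => a; have /rowP/(_ a) := cX0; rewrite !mxE summxE => sum0.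
  rewrite -[RHS]sum0; apply: eq_bigr => b _.
  by rewrite -tnth_nth !mxE.
have [V mulV Vspan] := span_mul_vspace K L.
have imgV : (linfun (mulmxr X) @: V)%VS = fullv.
  apply: trace_separation => S trS.
  pose T := X *m S; apply/eqP; apply: contraT => S0.
  have T0 : T != 0.
    by apply: contraNneq S0 => T0; rewrite -[S]mul1mx -EX -mulmxA -/T T0 mulmx0.
  have rkT : (\rank T <= k + l)%N.
    by rewrite (leq_trans (mulmx_max_rank _ _)).
  have [B [BL BT0 rkBT]] := ktransitive_low_rank n_gt0 k_gt0 l_gt0 Ltrans T0 rkT.
  have [A AK] := ktransitive_trace Ktrans BT0 rkBT.
  case/eqP; rewrite /T !mulmxA; apply: trS.
  by apply/memv_imgP; exists (A *m B); rewrite ?mulV // lfunE.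
have /memv_imgP [A /Vspan AV] : Y \in (linfun (mulmxr X) @: V)%VS.
  by rewrite imgV memvf.
rewrite lfunE /= => defY; exists A => // i; apply/colP => a.
have := congr1 (fun M : 'M_(m, q) => M a i) defY; rewrite !mxE => ->.
by apply: eq_bigr => b _; rewrite mxE.
Qed.

Theorem theorem4p9 (R : realType) (m n p k l : nat)
    (K : {vspace 'M[R[i]]_(m, n)}) (L : {vspace 'M[R[i]]_(n, p)}) :
  (0 < m)%N -> (0 < n)%N -> (0 < p)%N -> (0 < k)%N -> (0 < l)%N ->
  ktransitive k [set` K] -> ktransitive l [set` L] ->
  ktransitive (minn (k + l) (minn m p)) (span_mul K L).
Proof.
move=> _ n_gt0 _ k_gt0 l_gt0; apply: span_mul_ktransitive => //.
  by rewrite minnC geq_min geq_minr.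
exact: geq_minl.
Qed.
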